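(* Let $\rho\colon\mathfrak{sl}_2(\mathbf{C})\to\mathfrak{gl}(V)$ be an irreducible finite-dimensional complex representation of the Lie algebra $\mathfrak{sl}_2(\mathbf{C})$. Then $V$ exhibits optimal monomial Lie-additive diameters, i.e. for every nonzero linear subspace $U\leq V$, \[ \mathrm{diam}_+^{\mathfrak{sl}_2(\mathbf{C}),\mathrm{mon}}(V,U)=\left\lceil\frac{\dim V}{\dim U}\right\rceil . \]
   Context: Let $L$ be a complex Lie algebra with a representation $\rho\colon L\to\mathfrak{gl}(V)$. Let $\mathrm{mon}(\rho(L))$ be the set of all monomials $\rho(x_1)\cdots\rho(x_k)\in\mathfrak{gl}(V)$ (composition of endomorphisms) with $x_1,\dots,x_k\in L$ and $k\geq 0$; the empty monomial ($k=0$) is the identity. For a subspace $U\leq V$, the monomial $L$-additive diameter of $V$ with respect to $U$ is \[ \mathrm{diam}_+^{L,\mathrm{mon}}(V,U)=\min\{d\mid V=m_1\cdot U+\cdots+m_d\cdot U,\ m_i\in\mathrm{mon}(\rho(L))\}. \] *)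

(* Defs.v *)
From HB Require Import structures.
From mathcomp Require Import all_boot all_order all_algebra.
From mathcomp Require Import ring complex boolp reals.

Set Implicit Arguments.
Unset Strict Implicit.
Unset Printing Implicit Defensive.

Import GRing.Theory Num.Theory.
Local Open Scope ring_scope.

HB.mixin Record Lmodule_isLieAlgebra (K : fieldType) L
    of GRing.Lmodule K L := {
  lie_bracket : L -> L -> L;
  lie_bracket_linearl : forall y, linear (lie_bracket^~ y);
  lie_bracket_linearr : forall x, linear (lie_bracket x);
  lie_bracketxx : forall x, lie_bracket x x = 0;
  lie_jacobi : forall x y z,
    lie_bracket x (lie_bracket y z) + lie_bracket y (lie_bracket z x)
      + lie_bracket z (lie_bracket x y) = 0
}.

#[short(type="lieAlgType")]
HB.structure Definition LieAlgebra (K : fieldType) :=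
  { L of GRing.Lmodule K L & Lmodule_isLieAlgebra K L }.

Section SpecialLinear.
Variable K : fieldType.

Definition traceless : {pred 'M[K]_2} := [pred A : 'M[K]_2 | \tr A == 0].

Fact traceless_submod : submod_closed traceless.
Proof.
split; first by rewrite inE mxtrace0.
move=> a A B; rewrite !inE => /eqP trA /eqP trB.
by rewrite mxtraceD mxtraceZ trA trB mulr0 addr0.
Qed.

HB.instance Definition _ :=
  GRing.isSubmodClosed.Build K 'M[K]_2 traceless traceless_submod.

Record sl2 : Type := Sl2 { sl2_mx :> 'M[K]_2; _ : sl2_mx \in traceless }.

HB.instance Definition _ := [isSub for sl2_mx].
HB.instance Definition _ := [Choice of sl2 by <:].
HB.instance Definition _ := [SubChoice_isSubLmodule of sl2 by <:].

Fact sl2_bracket_subproof (x y : sl2) :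
  sl2_mx x *m sl2_mx y - sl2_mx y *m sl2_mx x \in traceless.
Proof. by rewrite inE raddfB /= mxtrace_mulC subrr. Qed.

Definition sl2_bracket (x y : sl2) : sl2 := Sl2 (sl2_bracket_subproof x y).

Fact sl2_bracket_linearl y : linear (sl2_bracket^~ y).
Proof.
move=> a x z; apply: val_inj => /=.
rewrite mulmxDl mulmxDr -scalemxAl -scalemxAr scalerBr opprD.
by rewrite addrACA.
Qed.

Fact sl2_bracket_linearr x : linear (sl2_bracket x).
Proof.
move=> a y z; apply: val_inj => /=.
rewrite mulmxDl mulmxDr -scalemxAl -scalemxAr scalerBr opprD.
by rewrite addrACA.
Qed.

Fact sl2_bracketxx x : sl2_bracket x x = 0.
Proof. by apply: val_inj; rewrite /= subrr. Qed.

Fact sl2_jacobi x y z :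
  sl2_bracket x (sl2_bracket y z) + sl2_bracket y (sl2_bracket z x)
    + sl2_bracket z (sl2_bracket x y) = 0.
Proof.
apply: val_inj => /=; rewrite !mulmxBl !mulmxBr !mulmxA !opprB.
move: (x *m y *m z) (x *m z *m y) (y *m z *m x) => a b c.
move: (y *m x *m z) (z *m x *m y) (z *m y *m x) => d e f.
by apply/matrixP=> i j; rewrite !mxE; ring.
Qed.

HB.instance Definition _ := Lmodule_isLieAlgebra.Build K sl2
  sl2_bracket_linearl sl2_bracket_linearr sl2_bracketxx sl2_jacobi.

End SpecialLinear.

Section Representations.
Variables (K : fieldType) (L : lieAlgType K) (V : vectType K).

Record lie_repr : Type := LieRepr {
  lie_repr_fun :> {linear L -> 'End(V)};
  _ : forall x y, lie_repr_fun (lie_bracket x y) =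
        (lie_repr_fun x \o lie_repr_fun y)%VF
          - (lie_repr_fun y \o lie_repr_fun x)%VF
}.

Implicit Types (rho : lie_repr) (U W : {vspace V}).

Definition irreducible_repr rho : Prop :=
  ({:V} != 0)%VS /\
  forall W, (forall x, (rho x @: W <= W)%VS) -> W = 0%VS \/ W = {:V}%VS.

Definition monomial rho (s : seq L) : 'End(V) :=
  foldr (fun x f => (rho x \o f)%VF) \1%VF s.

Definition mon rho (m : 'End(V)) : Prop := exists s, m = monomial rho s.

Definition mon_covers rho U (d : nat) : Prop :=
  exists m : 'I_d -> 'End(V),
    (forall i, mon rho (m i)) /\ {:V}%VS = (\sum_(i < d) m i @: U)%VS.

(* The minimum of the set of admissible d; None when that set is empty. *)
Definition mon_diam rho U : option nat :=
  if pselect (exists d, `[< mon_covers rho U d >]) is left ex_d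
  then Some (ex_minn ex_d) else None.

End Representations.

(* Main.v *)
From HB Require Import structures.
Require Import Defs.
From mathcomp Require Import all_boot all_order all_algebra.
From mathcomp Require Import ring spectral complex boolp reals.

(* The monomials used are powers of one nilpotent element y of sl_2. If
   k = dim U and V = U + y^k V, then substituting this equation into itself
   gives V = U + y^k U + y^(2k) U + ..., which stops after ceil (dim V / k)
   terms because y^(dim V) = 0. To find y, take a functional xi on V which is
   an h-eigenvector and satisfies xi f = 0: then v |-> xi (exp (t e) v) embeds
   V into the polynomials in t, with e acting as d/dt, and the nilpotent
   y = f - a h - a^2 e acts as lam (t - a) - (t - a)^2 d/dt, so that every
   element of y^k V vanishes to order k at a. Independent polynomials u_1, ...,
   u_k have a nonzero Wronskian, hence for generic a no nonzero element of U
   vanishes to order k at a, and U meets y^k V trivially. *)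

Set Implicit Arguments.
Unset Strict Implicit.
Unset Printing Implicit Defensive.

Import Order.TTheory GRing.Theory Num.Theory VectorInternalTheory.

Local Open Scope ring_scope.

(** * Wronskians and vanishing orders of polynomials *)

Section Polynomials.
Variable F : numFieldType.
Implicit Types (p q r : {poly F}) (a c : F).

(** In characteristic zero the points [a + c *+ j] with [j < size p] are distinct, and they are too
    many to be all roots of [p]. *)
Lemma exists_shift_nonroot p a c : p != 0 -> c != 0 ->
  exists j, ~~ root p (a + c *+ j).
Proof.
move=> p_neq0 c_neq0; set s := [seq a + c *+ j | j <- iota 0 (size p)].
have s_uniq : uniq s.
  rewrite map_inj_uniq ?iota_uniq // => i j /addrI/eqP.
  rewrite -[c *+ i]mulr_natr -[c *+ j]mulr_natr (inj_eq (mulfI c_neq0)) eqr_nat.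
  by move/eqP.
case: (boolP (all (root p) s)) => [s_root | /allPn[x /mapP[j _ ->] ?]].
  have := max_poly_roots p_neq0 s_root s_uniq.
  by rewrite size_map size_iota ltnn.
by exists j.
Qed.

Definition wronskian p q := p * q^`() - p^`() * q.

Fact wronskian_is_linear p : linear (wronskian p).
Proof.
by move=> c q r; rewrite /wronskian derivD derivZ -!mul_polyC; ring.
Qed.

HB.instance Definition _ p :=
  GRing.isLinear.Build F {poly F} {poly F} *:%R (wronskian p)
    (wronskian_is_linear p).

Lemma wronskianpp p : wronskian p p = 0.
Proof. by rewrite /wronskian mulrC subrr. Qed.

Lemma coef_XM_deriv p i : ('X * p^`())`_i = p`_i *+ i.
Proof. by rewrite coefXM; case: i => [|i] //=; rewrite coef_deriv. Qed.

(** A comparison of degrees. Subtract from [q] the multiple of [p] that cancels the coefficient at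
    [d], the degree of [p]. If the remainder [r] is nonzero, its degree differs from [d], so the
    operator [D], which scales the monomial of degree [i] by [i - d], keeps the top term of [r] but
    kills that of [p]. This contradicts [p * D r = D p * r]. *)
Lemma wronskian_eq0 p q : p != 0 -> wronskian p q = 0 -> exists c, q = c *: p.
Proof.
move=> p_neq0 pq0; pose d := (size p).-1.
have pd : p`_d != 0 by rewrite -/(lead_coef p) lead_coef_eq0.
exists (q`_d / p`_d); apply/eqP; rewrite -subr_eq0; set r := _ - _.
have rd : r`_d = 0 by rewrite coefB coefZ divfK // subrr.
have pr0 : wronskian p r = 0.
  by rewrite linearB linearZ /= pq0 wronskianpp scaler0 subr0.
apply: contraTT isT => r_neq0.
pose D (s : {poly F}) := 'X * s^`() - s *+ d.
have coefD s i : (D s)`_i = s`_i *+ i - s`_i *+ d.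
  by rewrite coefB coefMn coef_XM_deriv.
have Dpr : p * D r = D p * r.
  have : 'X * wronskian p r = 0 by rewrite pr0 mulr0.
  rewrite /wronskian /D => E.
  by apply/eqP; rewrite -subr_eq0 -E; apply/eqP; ring.
pose m := (size r).-1.
have rm : r`_m != 0 by rewrite -/(lead_coef r) lead_coef_eq0.
have neq_md : m != d by apply: contraNneq rm => ->; rewrite rd.
have size_r : size r = m.+1 by rewrite prednK // lt0n size_poly_eq0.
have size_p : size p = d.+1 by rewrite prednK // lt0n size_poly_eq0.
have Drm : (D r)`_m != 0.
  by rewrite coefD subr_eq0 -[_ *+ m]mulr_natr -[_ *+ d]mulr_natr
             (inj_eq (mulfI rm)) eqr_nat.
have size_Dr : (m < size (D r))%N.
  by rewrite ltnNge; apply: contra Drm => /leq_sizeP->.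
have Dr_neq0 : D r != 0 by apply: contraNneq Drm => ->; rewrite coef0.
have size_Dp : (size (D p) <= d)%N.
  apply/leq_sizeP => j; rewrite leq_eqVlt coefD => /predU1P[<-|dj].
    by rewrite subrr.
  by rewrite nth_default ?size_p // !mul0rn subrr.
have := congr1 (size : {poly F} -> nat) Dpr.
rewrite size_mul // size_p addSn /=.
have [-> | Dp_neq0] := eqVneq (D p) 0.
  rewrite mul0r size_poly0 => /eqP.
  by rewrite addn_eq0 (gtn_eqF (leq_ltn_trans _ size_Dr)) ?andbF.
rewrite size_mul // size_r addnS /= => E.
by have := leq_add (leqnn d) size_Dr; rewrite E addnS ltnNge leq_add2r size_Dp.
Qed.

Lemma dvdp_wronskian p q r k : r ^+ k.+1 %| q -> r ^+ k %| wronskian p q.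
Proof.
case/dvdpP => s ->; apply/dvdpP.
exists (p * s^`() * r + (p * s * r^`()) *+ k.+1 - p^`() * s * r).
by rewrite /wronskian derivM deriv_exp /= exprS; ring.
Qed.

(* Induction on [k]: passing from [u i] to its Wronskian with [u 0] preserves
   independence and lowers the vanishing order at any [a] by at most one. *)
Lemma generic_vanishing_order k (u : 'I_k -> {poly F}) :
    (forall c : 'I_k -> F, \sum_i c i *: u i = 0 -> forall i, c i = 0) ->
  exists2 B : {poly F}, B != 0 & forall a, ~~ root B a ->
    forall c : 'I_k -> F, ('X - a%:P) ^+ k %| \sum_i c i *: u i ->
    forall i, c i = 0.
Proof.
elim: k u => [|k IHk] u u_free.
  by exists 1 => [|a _ c _ []]; rewrite ?oner_eq0.
pose p := u ord0; pose w i := wronskian p (u (lift ord0 i)).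
have u0_neq0 : p != 0.
  apply/eqP => p0; have /eqP := oner_eq0 F; apply.
  apply: (u_free (fun i => (i == ord0)%:R) _ ord0).
  rewrite big_ord_recl /= scale1r -/p p0 add0r big1 // => i _.
  by rewrite scale0r.
have wE (c : 'I_k.+1 -> F) :
    wronskian p (\sum_i c i *: u i) = \sum_i c (lift ord0 i) *: w i.
  rewrite linear_sum big_ord_recl /= linearZ /= wronskianpp scaler0 add0r.
  by apply: eq_bigr => i _; rewrite linearZ.
have w_free (c : 'I_k -> F) : \sum_i c i *: w i = 0 -> forall i, c i = 0.
  (* [c' x] extends [c] by the coefficient [x] at [ord0]. Taking 0 there gives a combination with
     zero Wronskian, hence equal to some [x *: p]; taking [- x] then gives a relation among the
     [u i]. *)
  pose c' x (i : 'I_k.+1) := if unlift ord0 i is Some j then c j else x.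
  have c'l x i : c' x (lift ord0 i) = c i by rewrite /c' liftK.
  have c'0 x : c' x ord0 = x by rewrite /c' unlift_none.
  move=> cw0.
  have /(wronskian_eq0 u0_neq0)[x Ex] : wronskian p (\sum_i c' 0 i *: u i) = 0.
    by rewrite wE -[RHS]cw0; apply: eq_bigr => i _; rewrite c'l.
  have c'_eq0 : \sum_i c' (- x) i *: u i = 0.
    move: Ex; rewrite !big_ord_recl !c'0 scale0r add0r => Ex.
    under eq_bigr do rewrite (c'l _ _) -(c'l 0).
    by rewrite Ex scaleNr -/p addNr.
  by move=> i; rewrite -(c'l (- x)); apply: u_free.
have [B B_neq0 HB] := IHk w w_free.
(* The factor [B] makes all coefficients but the first vanish; the factor [p] handles the first one,
   since [p] does not vanish at [a]. *)
exists (p * B) => [|a]; first by rewrite mulf_neq0.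
rewrite rootM negb_or => /andP[pa Ba] c cu.
have cl i : c (lift ord0 i) = 0.
  apply: (HB a Ba (fun i => c (lift ord0 i))).
  by rewrite -wE dvdp_wronskian.
move=> i; case: (unliftP ord0 i) => [j ->|->]; first exact: cl.
move: cu; rewrite big_ord_recl big1 ?addr0 => [|j _]; last first.
  by rewrite cl scale0r.
apply: contraTeq => c0; rewrite dvdpZr //; apply: contra pa => /(dvdp_trans _).
by rewrite -/p -dvdp_XsubCl; apply; rewrite exprS dvdp_mulr.
Qed.

End Polynomials.

(** * Ladder operators *)

Section ShiftedEigenvectors.
Variables (F : numFieldType) (n : nat) (A B : 'M[F]_n) (a c : F) (x : 'cV[F]_n).
Hypothesis AB : A *m B = B *m A + c *: B.
Hypothesis Ax : A *m x = a *: x.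

Lemma shifted_eigenvector j :
  A *m iter j (mulmx B) x = (a + c *+ j) *: iter j (mulmx B) x.
Proof.
elim: j => [|j IHj] /=; first by rewrite addr0.
rewrite mulmxA AB mulmxDl -mulmxA IHj -scalemxAr -scalemxAl -scalerDl.
by rewrite mulrSr addrA.
Qed.

(** Some [a + c *+ j] is not an eigenvalue of [A], so the corresponding iterate cannot be an
    eigenvector. The transposes appear because [eigenvalue] is about row vectors. *)
Lemma shifted_eigenvector_eq0 : c != 0 ->
  exists j, iter j (mulmx B) x = 0.
Proof.
move=> c_neq0.
have [|j] := exists_shift_nonroot a (p := char_poly A^T) _ c_neq0.
  exact: monic_neq0 (char_poly_monic _).
rewrite -eigenvalue_root_char => /eigenvalueP noteig; exists j.
apply: contra_notP noteig => /eqP y_neq0.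
exists (iter j (mulmx B) x)^T; last by rewrite -trmx0 (inj_eq trmx_inj).
by rewrite -trmx_mul shifted_eigenvector linearZ.
Qed.

End ShiftedEigenvectors.

(** * The standard basis of sl_2 *)

Section Sl2Basis.
Variable K : fieldType.

Definition sl2_mat (a b c : K) : 'M[K]_2 :=
  \matrix_(i, j) if i == 0 then (if j == 0 then a else b)
                 else (if j == 0 then c else - a).

Fact sl2_mat_traceless a b c : sl2_mat a b c \in @traceless K.
Proof. by rewrite inE /mxtrace big_ord_recl big_ord1 !mxE /= subrr. Qed.

Definition sl2_coord a b c : sl2 K := Sl2 (sl2_mat_traceless a b c).

Definition sl2H := sl2_coord 1 0 0.
Definition sl2E := sl2_coord 0 1 0.
Definition sl2F := sl2_coord 0 0 1.

Lemma sl2_coordE a b c : sl2_coord a b c = a *: sl2H + b *: sl2E + c *: sl2F.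
Proof.
apply/val_inj/matrixP => i j; rewrite /= !mxE.
by case: (i == 0); case: (j == 0); ring.
Qed.

Lemma sl2_decomp (y : sl2 K) : exists a b c, y = sl2_coord a b c.
Proof.
exists (sl2_mx y 0 0), (sl2_mx y 0 1), (sl2_mx y 1 0).
apply/val_inj/matrixP => i j.
have /eqP : sl2_mx y \in @traceless K by case: (y).
rewrite /mxtrace big_ord_recl big_ord1 /= => tr_y.
have y11 : sl2_mx y 1 1 = - sl2_mx y 0 0.
  apply/eqP; rewrite -addr_eq0 addrC -tr_y; apply/eqP.
  by congr (_ + sl2_mx y _ _); apply/val_inj.
rewrite mxE.
by case: (unliftP 0 i) => [i' ->|->]; case: (unliftP 0 j) => [j' ->|->] //=;
   rewrite ?(ord1 i') ?(ord1 j') -?y11; congr (sl2_mx y _ _); apply/val_inj.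
Qed.

Lemma sl2_bracketEF : lie_bracket sl2E sl2F = sl2H.
Proof.
apply/val_inj/matrixP => i j; rewrite /= !mxE !big_ord_recl !big_ord0 !mxE /=.
by case: (i == 0); case: (j == 0); ring.
Qed.

Lemma sl2_bracketHE : lie_bracket sl2H sl2E = sl2E *+ 2.
Proof.
apply/val_inj/matrixP => i j; rewrite /= !mxE !big_ord_recl !big_ord0 !mxE /=.
by case: (i == 0); case: (j == 0); ring.
Qed.

Lemma sl2_bracketHF : lie_bracket sl2H sl2F = - (sl2F *+ 2).
Proof.
apply/val_inj/matrixP => i j; rewrite /= !mxE !big_ord_recl !big_ord0 !mxE /=.
by case: (i == 0); case: (j == 0); ring.
Qed.

End Sl2Basis.

(** * Matrices of linear maps and of representations *)

Lemma v2r_lfun (K : fieldType) (V W : vectType K) (f : 'Hom(V, W)) v :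
  v2r (f v) = v2r v *m f2mx f.
Proof. by rewrite unlock /= r2vK. Qed.

Lemma lfun_mx_ext (K : fieldType) (V : vectType K) m (A B : 'M[K]_(_, m)) :
  (forall v : V, v2r v *m A = v2r v *m B) -> A = B.
Proof.
by move=> AB; apply/row_matrixP => i; rewrite !rowE -[delta_mx _ _]r2vK AB.
Qed.

Section LieRepr.
Variables (K : fieldType) (L : lieAlgType K) (V : vectType K).
Variable rho : lie_repr L V.

Lemma lie_reprE y z v :
  rho y (rho z v) = rho z (rho y v) + rho (lie_bracket y z) v.
Proof.
case: rho => r r_bracket /=.
by rewrite r_bracket !lfun_simp addrC subrK.
Qed.

(** Vectors are rows and matrices act on the right, so products come in the order opposite to
    composition. Hence the signs in [mx_EF], [mx_HE] and [mx_HF]. *)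
Lemma lie_repr_mx y z : f2mx (rho z) *m f2mx (rho y) =
  f2mx (rho y) *m f2mx (rho z) + f2mx (rho (lie_bracket y z)).
Proof.
apply: lfun_mx_ext => v; rewrite mulmxDr !mulmxA -!v2r_lfun.
by rewrite lie_reprE linearD.
Qed.

End LieRepr.

(** * The lowest weight functional and the polynomial model *)

Section LowestWeight.
Variables (K : numClosedFieldType) (V : vectType K) (rho : lie_repr (sl2 K) V).

Local Notation E := (f2mx (rho (sl2E K))).
Local Notation H := (f2mx (rho (sl2H K))).
Local Notation F := (f2mx (rho (sl2F K))).

Fact mx_EF : E *m F = F *m E - H.
Proof. by rewrite (lie_repr_mx rho (sl2E K) (sl2F K)) sl2_bracketEF addrK. Qed.

Fact mx_HE : H *m E = E *m H + (- 2) *: E.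
Proof.
rewrite (lie_repr_mx rho (sl2H K) (sl2E K)) sl2_bracketHE.
have -> : f2mx (rho (sl2E K *+ 2)) = 2 *: E.
  apply: lfun_mx_ext => v; rewrite -scalemxAr -!v2r_lfun (raddfMn rho).
  by rewrite mulr2n !lfun_simp linearD scaler_nat mulr2n.
by rewrite scaleNr addrK.
Qed.

Fact mx_HF : H *m F = F *m H + 2 *: F.
Proof.
rewrite (lie_repr_mx rho (sl2H K) (sl2F K)) sl2_bracketHF.
have -> : f2mx (rho (- (sl2F K *+ 2))) = - (2 *: F).
  apply: lfun_mx_ext => v; rewrite mulmxN -scalemxAr -!v2r_lfun (raddfN rho).
  by rewrite (raddfMn rho) mulr2n !lfun_simp linearN linearD scaler_nat mulr2n.
by rewrite subrK.
Qed.

(* Columns [x j] stand for the functionals [v |-> xi (rho (sl2E K) ^ j v)]. *)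
Lemma lowest_weight_functional : ({:V} != 0)%VS ->
  exists lam (x : nat -> 'cV[K]_(dim V)) M,
    [/\ x 0%N != 0, forall j, (M <= j)%N -> x j = 0,
        forall j, E *m x j = x j.+1, F *m x 0%N = 0
      & (forall j, H *m x j = (lam - j.*2%:R) *: x j) /\
        (forall j, F *m x j.+1 = (j.+1%:R * (lam - j%:R)) *: x j)].
Proof.
move=> V_neq0; have dimV_gt0 : (0 < dim V)%N by rewrite -dimvf lt0n dimv_eq0.
have [mu /eigenvalueP[y Hy y_neq0]] := eigenvalue_closed H^T dimV_gt0.
have Hy' : H *m y^T = mu *: y^T by rewrite -linearZ -Hy /= trmx_mul trmxK.
have two_neq0 : 2 != 0 :> K by rewrite pnatr_eq0.
have [j0 Fy0] := shifted_eigenvector_eq0 mx_HF Hy' two_neq0.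
have ex_j : exists j, iter j (mulmx F) y^T == 0 by exists j0; apply/eqP.
(* [F] shifts the eigenvalue of [H] by 2, so its iterates on [y^T] reach 0; the last nonzero one is
   an eigenvector of [H] killed by [F]. *)
case: (ex_minnP ex_j) => -[|j] Fj0 min_j.
  by case/negP: y_neq0; rewrite -(inj_eq trmx_inj) trmx0.
pose x0 := iter j (mulmx F) y^T; pose lam := mu + 2 *+ j.
have x0_neq0 : x0 != 0.
  apply: contraTneq (leqnn j) => x0E.
  by rewrite -ltnNge min_j //; apply/eqP.
have Hx0 : H *m x0 = lam *: x0 := shifted_eigenvector mx_HF Hy' j.
pose x i := iter i (mulmx E) x0.
have twoN_neq0 : - 2 != 0 :> K by rewrite oppr_eq0.
have [M xM] := shifted_eigenvector_eq0 mx_HE Hx0 twoN_neq0.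
have Hx i : H *m x i = (lam - i.*2%:R) *: x i.
  by rewrite (shifted_eigenvector mx_HE Hx0) -mul2n natrM mulr_natr mulNrn.
have Fx0 : F *m x0 = 0 by apply/eqP.
have xS i : E *m x i = x i.+1 by [].
exists lam, x, M; split=> //.
  move=> i /subnK<-; elim: (i - M)%N => [|k IHk] //.
  by rewrite addSn -xS IHk mulmx0.
(* Moving [F] past [E] adds [H] each time, and the sum of [lam - 2k] for [k] from 0 to [i] is
   [(i + 1) * (lam - i)]. *)
split=> //; elim=> [|i IHi].
  rewrite -xS mulmxA -[F *m E](subrK H) -mx_EF mulmxDl -mulmxA Fx0 mulmx0 add0r.
  by rewrite Hx mul1r.
rewrite -xS mulmxA -[F *m E](subrK H) -mx_EF mulmxDl -mulmxA IHi Hx.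
rewrite -scalemxAr xS -scalerDl; congr (_ *: _).
by rewrite -mul2n natrM -(natr1 i.+1) -(natr1 i); ring.
Qed.

End LowestWeight.

(** [P v] is the generating function of the values [xi j v / j!], so the shift of [j] caused by [E]
    becomes differentiation. The kernel of [P] is a subrepresentation other than the whole of [V],
    hence zero by irreducibility. *)
Lemma sl2_polynomial_model (K : numClosedFieldType) (V : vectType K)
    (rho : lie_repr (sl2 K) V) : irreducible_repr rho ->
  exists lam M (P : {linear V -> {poly K}}),
    [/\ forall v, P v = 0 -> v = 0, forall v, (size (P v) <= M)%N,
        forall v, P (rho (sl2E K) v) = (P v)^`(),
        forall v, P (rho (sl2H K) v) = lam *: P v - ('X * (P v)^`()) *+ 2
      & forall v, P (rho (sl2F K) v) = lam *: ('X * P v) - 'X^2 * (P v)^`()].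
Proof.
case=> V_neq0 irr_rho.
have [lam [x [M [x0_neq0 xM Ex Fx0 [Hx Fx]]]]] :=
  lowest_weight_functional rho V_neq0.
pose xi j v := (v2r v *m x j) 0 0.
have xi_lin j c u v : xi j (c *: u + v) = c * xi j u + xi j v.
  by rewrite /xi linearP mulmxDl -scalemxAl !mxE.
have xiE j v : xi j (rho (sl2E K) v) = xi j.+1 v.
  by rewrite /xi v2r_lfun -mulmxA Ex.
have xiH j v : xi j (rho (sl2H K) v) = (lam - j.*2%:R) * xi j v.
  by rewrite /xi v2r_lfun -mulmxA Hx -scalemxAr mxE.
have xiF0 v : xi 0%N (rho (sl2F K) v) = 0.
  by rewrite /xi v2r_lfun -mulmxA Fx0 mulmx0 mxE.
have xiF j v : xi j.+1 (rho (sl2F K) v) = j.+1%:R * (lam - j%:R) * xi j v.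
  by rewrite /xi v2r_lfun -mulmxA Fx -scalemxAr mxE.
pose P v := \poly_(j < M) (xi j v / j`!%:R).
have coefP v j : (P v)`_j = xi j v / j`!%:R.
  rewrite coef_poly; case: ltnP => // /xM xj0.
  by rewrite /xi xj0 mulmx0 mxE mul0r.
have fact_neq0 j : j`!%:R != 0 :> K by rewrite pnatr_eq0 -lt0n fact_gt0.
have P_lin : linear P.
  move=> c u v; apply/polyP=> j.
  by rewrite coefD coefZ !coefP xi_lin mulrDl mulrA.
have PE v : P (rho (sl2E K) v) = (P v)^`().
  apply/polyP=> j; rewrite coef_deriv !coefP xiE factS natrM -mulr_natl.
  by field; rewrite fact_neq0 nat1r pnatr_eq0.
have PH v : P (rho (sl2H K) v) = lam *: P v - ('X * (P v)^`()) *+ 2.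
  apply/polyP=> j; rewrite coefB coefZ coefMn coef_XM_deriv !coefP xiH.
  by rewrite -mul2n natrM -[_ *+ j]mulr_natr; ring.
have PF v : P (rho (sl2F K) v) = lam *: ('X * P v) - 'X^2 * (P v)^`().
  apply/polyP=> j; rewrite expr2 -mulrA coefB coefZ !coefXM.
  case: j => [|j] /=; first by rewrite coefP xiF0 mul0r mulr0 subr0.
  rewrite -coefXM coef_XM_deriv !coefP xiF factS natrM -[_ *+ j]mulr_natr.
  by field; rewrite fact_neq0 nat1r pnatr_eq0.
pose Plin : {linear V -> {poly K}} :=
  HB.pack P (GRing.isLinear.Build K V {poly K} *:%R P P_lin).
have Py0 y v : P v = 0 -> P (rho y v) = 0.
  move=> Pv0; have [a [b [c ->]]] := sl2_decomp y.
  rewrite sl2_coordE !(linearD, linearZ) /= !lfun_simp.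
  rewrite -![P _]/(Plin _) !(linearD, linearZ) /= PE PF PH Pv0.
  by rewrite deriv0 !(mulr0, scaler0, mul0rn, subr0, addr0).
(* [lker] needs a finite-dimensional codomain, so the kernel of [P] is expressed through the row of
   the values [xi j v]. *)
pose g v := \row_(j < M) xi j v.
have g_lin : linear g by move=> c u v; apply/rowP=> j; rewrite !mxE xi_lin.
pose glin : {linear V -> 'rV[K]_M} :=
  HB.pack g (GRing.isLinear.Build K V _ *:%R g g_lin).
have kerP v : (v \in lker (linfun glin)) <-> P v = 0.
  rewrite memv_ker lfunE /=; split=> [/eqP/rowP gv0 | Pv0].
    apply/polyP=> j; rewrite coef_poly coef0; case: ifP => // jM.
    by have := gv0 (Ordinal jM); rewrite !mxE /= => ->; rewrite mul0r.
  apply/eqP/rowP=> j; rewrite !mxE; apply/eqP.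
  have/eqP := coefP v j.
  by rewrite Pv0 coef0 eq_sym mulf_eq0 invr_eq0 (negPf (fact_neq0 _)) orbF.
exists lam, M, Plin; split=> // [v Pv0 | v]; last exact: size_poly.
case: (irr_rho (lker (linfun glin))) => [y | ker0 | kerT].
- apply/subvP=> _ /memv_imgP[u /kerP Pu0 ->]; apply/kerP; exact: Py0.
- by apply/eqP; rewrite -memv0 -ker0; apply/kerP.
(* If [P] were zero, its constant coefficient [xi 0 v] would vanish for all [v], forcing
   [x 0 = 0]. *)
case/negP: x0_neq0; apply/eqP/lfun_mx_ext => u.
have /kerP Pu0 : u \in lker (linfun glin) by rewrite kerT memvf.
have := coefP u 0%N; rewrite Pu0 coef0 fact0 divr1 mulmx0 => xi0.
by apply/matrixP=> i j; rewrite !ord1 -/(xi 0%N u) -xi0 mxE.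
Qed.

(** * Iterated images of an endomorphism *)

Section IteratedImage.
Variables (K : fieldType) (V : vectType K) (g : 'End(V)).
Implicit Types U W : {vspace V}.

Local Notation img m W := (iter m (lfun_img g) W).

Lemma iter_limgD m : {morph (fun W => img m W) : U W / (U + W)%VS}.
Proof. by move=> U W; elim: m => //= m ->; rewrite limgD. Qed.

Lemma iter_limgS m U W : (U <= W)%VS -> (img m U <= img m W)%VS.
Proof. by move=> sUW; elim: m => //= m; apply: limgS. Qed.

Lemma iter_limg_cover k U : (U + img k fullv)%VS = fullv ->
  forall d, (\sum_(i < d) img (i * k) U + img (d * k) fullv)%VS = fullv.
Proof.
move=> UV; elim=> [|d IHd]; first by rewrite big_ord0 add0v.
by rewrite big_ord_recr -addvA mulSnr iterD /= -iter_limgD UV IHd.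
Qed.

(** The images shrink strictly until they reach 0: if two consecutive ones agree, the chain is
    constant from there on, and it does reach 0. *)
Lemma dim_iter_limg_nilpotent M m :
  img M fullv = 0%VS -> (\dim (img m fullv) <= \dim {:V} - m)%N.
Proof.
move=> gM0; elim: m => [|m IHm]; first by rewrite subn0.
have [->|dim_neq] := eqVneq (img m.+1 fullv) 0%VS; first by rewrite dimv0.
have sub_m : (img m.+1 fullv <= img m fullv)%VS.
  by rewrite iterSr iter_limgS ?subvf.
suff lt_dim : (\dim (img m.+1 fullv) < \dim (img m fullv))%N.
  by rewrite subnS -ltnS (leq_trans lt_dim) // (leq_trans IHm) // leqSpred.
rewrite ltn_neqAle dimvS // andbT; apply: contra dim_neq => eq_dim.
have {}eq_dim : img m.+1 fullv = img m fullv.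
  by apply/eqP; rewrite eqEdim sub_m (eqP eq_dim) /=.
have stable j : img (j + m) fullv = img m fullv.
  by elim: j => // j IHj; rewrite addSn /= IHj.
rewrite eq_dim -(stable M) addnC iterD gM0.
by elim: (m) => //= i /eqP->; rewrite limg0.
Qed.

(** By rank-nullity each application of [g] loses at most one dimension. *)
Lemma dim_iter_limg_ker1 m :
  (\dim (lker g) <= 1)%N -> (\dim {:V} - m <= \dim (img m fullv))%N.
Proof.
move=> ker1; elim: m => [|m IHm]; first by rewrite subn0.
rewrite subnS -subn1 leq_subLR (leq_trans IHm) //= -(limg_ker_dim g) leq_add2r.
exact: leq_trans (dimvS (capvSr _ _)) ker1.
Qed.

End IteratedImage.

Lemma limg_monomial_nseq (K : fieldType) (L : lieAlgType K) (V : vectType K)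
    (rho : lie_repr L V) y m W :
  (monomial rho (nseq m y) @: W)%VS = iter m (lfun_img (rho y)) W.
Proof. by elim: m => [|m IHm] /=; rewrite ?lim1g // limg_comp IHm. Qed.

(** The lower bound on the diameter: each of the [d] summands is a linear image of [U], of dimension
    at most that of [U]. *)
Lemma mon_covers_dim (K : fieldType) (L : lieAlgType K) (V : vectType K)
    (rho : lie_repr L V) U d :
  mon_covers rho U d -> (\dim {:V} <= d * \dim U)%N.
Proof.
case=> m [_ ->]; apply: leq_trans (dimv_leq_sum _ _ _) _.
rewrite -[in leqRHS](card_ord d) -sum_nat_const leq_sum // => i _.
by rewrite -(limg_ker_dim (m i) U) leq_addl.
Qed.

(** * The generic nilpotent element and the covering it gives *)

Section Generic.
Variables (K : numClosedFieldType) (V : vectType K) (rho : lie_repr (sl2 K) V).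
Hypothesis irr_rho : irreducible_repr rho.

Lemma exists_generic_nilpotent (U : {vspace V}) : exists y M,
  iter M (lfun_img (rho y)) fullv = 0%VS /\
  (U + iter (\dim U) (lfun_img (rho y)) fullv)%VS = fullv.
Proof.
have [lam [M [P [P_inj P_size PE PH PF]]]] := sl2_polynomial_model irr_rho.
pose u (i : 'I_(\dim U)) := P (vbasis U)`_i.
have u_free (c : 'I_(\dim U) -> K) : \sum_i c i *: u i = 0 -> forall i, c i = 0.
  move=> cu0; apply/freeP; first exact: basis_free (vbasisP U).
  apply: P_inj; rewrite linear_sum -[RHS]cu0.
  by apply: eq_bigr => i _; rewrite linearZ.
have [B B_neq0 HB] := generic_vanishing_order u_free.
have [j] := exists_shift_nonroot 0 B_neq0 (oner_neq0 K).
move: (0 + _) => a /HB{}HB.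
(* This is f - a h - a^2 e, the conjugate of f by exp (- a e), which translates the model so that 0
   moves to [a]. *)
pose y := sl2_coord (- a) (- a ^+ 2) 1; exists y, M.+1.
have Py v : P (rho y v) = ('X - a%:P) * (lam *: P v - ('X - a%:P) * (P v)^`()).
  rewrite /y sl2_coordE !(linearD, linearZ) /= !lfun_simp.
  rewrite !(linearD, linearZ) /= PE PF PH -!mul_polyC !rmorphN rmorphXn /=.
  by ring.
have dvdP m v :
    v \in iter m (lfun_img (rho y)) fullv -> ('X - a%:P) ^+ m %| P v.
  elim: m v => [|m IHm] v; first by rewrite dvd1p.
  case/memv_imgP=> w /IHm/dvdpP[q Pw] ->; apply/dvdpP.
  exists (lam *: q - (q^`() * ('X - a%:P) + q *+ m)).
  rewrite Py Pw derivM deriv_exp derivXsubC mul1r exprS -!mul_polyC.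
  case: m {IHm Pw} => [|m] /=; first by rewrite !mulr0n; ring.
  by rewrite exprS; ring.
have ker1 : (\dim (lker (rho y)) <= 1)%N.
  have kerP v : v \in lker (rho y) -> lam *: P v = ('X - a%:P) * (P v)^`().
    rewrite memv_ker => /eqP yv0; have /eqP := Py v.
    rewrite yv0 linear0 eq_sym mulf_eq0 polyXsubC_eq0 /= subr_eq0.
    by move/eqP.
  have [->|ker_neq0] := eqVneq (lker (rho y)) 0%VS; first by rewrite dimv0.
  set w := vpick (lker (rho y)).
  have w_neq0 : w != 0 by rewrite vpick0.
  apply: leq_trans (dimvS (_ : _ <= <[w]>)%VS) _; last first.
    by rewrite dim_vline leq_b1.
  apply/subvP=> v v_ker.
  have Pw_neq0 : P w != 0 by apply: contra w_neq0 => /eqP/P_inj->.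
  have [|c Ec] := wronskian_eq0 (q := P v) Pw_neq0.
    apply: (mulfI (negbT (polyXsubC_eq0 a))); rewrite mulr0 /wronskian mulrBr.
    rewrite mulrCA -kerP // mulrA -kerP ?memv_pick //.
    by rewrite -!mul_polyC; ring.
  apply/vlineP; exists c; apply/eqP; rewrite -subr_eq0; apply/eqP/P_inj.
  by rewrite linearB linearZ /= Ec subrr.
split.
  apply/eqP; rewrite -subv0; apply/subvP=> v /dvdP Pv.
  rewrite memv0; apply/eqP/P_inj/eqP; apply: contraTT (P_size v) => Pv_neq0.
  rewrite -ltnNge.
  by have := dvdp_leq Pv_neq0 Pv; rewrite size_exp_XsubC; apply: leq_trans.
(* An element of the intersection maps to a combination of the [u i] vanishing to order [\dim U] at
   [a], which the choice of [a] excludes unless all coordinates are 0. *)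
have cap0 : (U :&: iter (\dim U) (lfun_img (rho y)) fullv)%VS = 0%VS.
  apply/eqP; rewrite -subv0; apply/subvP=> v /memv_capP[vU /dvdP].
  rewrite {1}(coord_vbasis vU) linear_sum.
  under eq_bigr do rewrite linearZ.
  move/(HB (fun i => coord (vbasis U) i v)) => c0.
  by rewrite (coord_vbasis vU) big1 ?mem0v // => i _; rewrite c0 scale0r.
(* The sum is direct, and by [ker1] the image has codimension at most [\dim U], so the dimensions
   fill [V]. *)
apply/eqP; rewrite eqEdim subvf dimv_disjoint_sum //.
by rewrite -leq_subLR dim_iter_limg_ker1.
Qed.

Lemma mon_covers_of_dim (U : {vspace V}) d :
  (\dim {:V} <= d * \dim U)%N -> mon_covers rho U d.
Proof.
move=> le_dim; have [y [M [yM0 yU]]] := exists_generic_nilpotent U.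
exists (fun i : 'I_d => monomial rho (nseq (i * \dim U) y)).
split=> [i|]; first by exists (nseq (i * \dim U) y).
rewrite -[LHS](iter_limg_cover yU d).
(* The remainder after [d] substitutions vanishes, since its dimension is at most
   [\dim {:V} - d * \dim U], which is 0. *)
have -> : iter (d * \dim U) (lfun_img (rho y)) fullv = 0%VS.
  apply/eqP; rewrite -dimv_eq0 -leqn0.
  by apply: leq_trans (dim_iter_limg_nilpotent _ yM0) _; rewrite leqn0 subn_eq0.
by rewrite addv0; apply: eq_bigr => i _; rewrite limg_monomial_nseq.
Qed.

End Generic.

(** * Ceilings and the value of the diameter *)

Lemma absz_ceil_ratio_leq (n k d : nat) : (0 < k)%N ->
  (`|Num.ceil (n%:R / k%:R : rat)| <= d)%N = (n <= d * k)%N.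
Proof.
move=> k_gt0; have x_ge0 : 0 <= n%:R / k%:R :> rat by rewrite divr_ge0 ?ler0n.
rewrite -lez_nat gez0_abs; last by rewrite ceil_ge0 (lt_le_trans _ x_ge0).
by rewrite ceil_le_int ler_pdivrMr ?ltr0n // -natrM ler_nat.
Qed.

Local Open Scope complex_scope.

Theorem theorem6p2 (R : realType) (V : vectType R[i])
    (rho : lie_repr (sl2 R[i]) V) (irr_rho : irreducible_repr rho)
    (U : {vspace V}) (U_neq0 : U != 0%VS) :
  mon_diam rho U =
    Some `|Num.ceil ((\dim {:V})%:R / (\dim U)%:R : rat)|%N.
Proof.
have dimU_gt0 : (0 < \dim U)%N by rewrite lt0n dimv_eq0.
set c := absz _.
(* The admissible [d] are exactly those with [c <= d], so the set is nonempty and its minimum is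
   [c]. *)
have coversP d : mon_covers rho U d <-> (c <= d)%N.
  rewrite absz_ceil_ratio_leq //.
  by split=> [/mon_covers_dim | /(mon_covers_of_dim irr_rho)].
rewrite /mon_diam; case: pselect => [ex_d | []]; last first.
  by exists c; apply/asboolP/coversP.
congr Some; case: (ex_minnP ex_d) => d /asboolP/coversP le_cd min_d.
by apply/eqP; rewrite eqn_leq le_cd min_d //; apply/asboolP/coversP.
Qed.
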